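(* Let $M$ be a simple matroid on a finite ground set $E$ with closure operator $\operatorname{cl}$ and set of circuits $\mathcal{C}$. Then $M$ has a unique minimal tropical basis if and only if for every $X \subseteq E$, \[ (E \setminus X) \perp \{ C \in \mathcal{C} \mid \operatorname{cl}(C) = C\} \iff \operatorname{cl}(X) = X. \]
   Context: A subset $\mathcal{C}' \subseteq \mathcal{C}$ is a tropical basis of $M$ if for every $X \subseteq E$ with $X \neq \operatorname{cl}(X)$ there exists $C \in \mathcal{C}'$ with $|C \setminus X| = 1$. A tropical basis $\mathcal{C}'$ is minimal if for every $C \in \mathcal{C}'$ the family $\mathcal{C}' \setminus \{C\}$ is not a tropical basis. For a family $\mathcal{D}$ of subsets of $E$ and $A \subseteq E$, $A \perp \mathcal{D}$ means $|A \cap D| \neq 1$ for every $D \in \mathcal{D}$. *)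

(* Defs.v *)
From mathcomp Require Import all_boot.

Set Implicit Arguments.
Unset Strict Implicit.
Unset Printing Implicit Defensive.

(* The ground set of the matroid is the whole finite type E. *)
Record matroid (E : finType) := Matroid {
  indep : {set {set E}};
  indep_set0 : set0 \in indep;
  indep_subset : forall I J : {set E},
    J \in indep -> I \subset J -> I \in indep;
  indep_augment : forall I J : {set E},
    I \in indep -> J \in indep -> #|I| < #|J| ->
    exists2 e, e \in J :\: I & e |: I \in indep
}.

Section MatroidNotions.
Variables (E : finType) (M : matroid E).

Definition circuits : {set {set E}} :=
  [set C | minset (fun D : {set E} => D \notin indep M) C].

Definition rank (X : {set E}) : nat :=
  \max_(I in indep M | I \subset X) #|I|.

Definition cl (X : {set E}) : {set E} :=
  [set e | rank (e |: X) == rank X].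

Definition is_loop (e : E) : bool := [set e] \in circuits.

Definition is_parallel (e f : E) : bool :=
  (e != f) && ([set e; f] \in circuits).

Definition simple_matroid : Prop :=
  (forall e, ~~ is_loop e) /\ (forall e f, ~~ is_parallel e f).

Definition tropical_basis (B : {set {set E}}) : Prop :=
  B \subset circuits /\
  forall X : {set E}, X <> cl X -> exists2 C, C \in B & #|C :\: X| = 1.

(* Removing single circuits suffices: a family of circuits containing a
   tropical basis is again a tropical basis. *)
Definition minimal_tropical_basis (B : {set {set E}}) : Prop :=
  tropical_basis B /\ forall C, C \in B -> ~ tropical_basis (B :\ C).

End MatroidNotions.

Definition perp (E : finType) (A : {set E}) (D : {set {set E}}) : Prop :=
  forall S, S \in D -> #|A :&: S| <> 1.

(* Main.v *)
Require Import Defs.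
From mathcomp Require Import all_boot.

(** The circuits that are flats lie in every tropical basis: if [C] is a closed
circuit and [e \in C], then [C] is the only circuit meeting the complement of
[C :\ e] in one element.  Conversely, if all circuits except [C] do not form a
tropical basis, some non-closed [X] has [C] as its only circuit with
[C :\: X] a singleton [[set e]]; an element [f] of [cl C :\: C] would then lie
in [X], and exchanging [f] with a suitable [g \in C :\ e] would give a second
such circuit.  So [C] is closed.  Hence a unique minimal tropical basis exists
exactly when the closed circuits form a tropical basis. *)

Section Matroid.
Set Implicit Arguments.
Unset Strict Implicit.
Variables (E : finType) (M : matroid E).
Implicit Types (X Y C D I J : {set E}) (e f g : E) (B : {set {set E}}).

(** * Rank and maximal independent subsets *)

Lemma rank_max X I : I \in indep M -> I \subset X -> #|I| <= rank M X.
Proof. by move=> iI sIX; apply: leq_bigmax_cond; rewrite iI. Qed.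

Lemma rank_witness X :
  exists I, [/\ I \in indep M, I \subset X & #|I| = rank M X].
Proof.
have P0 : (set0 \in indep M) && (set0 \subset X) by rewrite indep_set0 sub0set.
rewrite /rank (bigmax_eq_arg set0) //.
by case: arg_maxnP => // I /andP[iI sIX] _; exists I.
Qed.

Lemma rank_mono X Y : X \subset Y -> rank M X <= rank M Y.
Proof.
move=> sXY; have [I [iI sIX <-]] := rank_witness X.
exact: rank_max iI (subset_trans sIX sXY).
Qed.

(** An inclusion-maximal independent [J] between [I] and [X] has full rank: otherwise augmenting it
    from a set that realises the rank of [X] would enlarge it inside [X]. *)
Lemma indep_extend X I : I \in indep M -> I \subset X ->
  exists J, [/\ J \in indep M, I \subset J, J \subset X & #|J| = rank M X].
Proof.
move=> iI sIX; pose P := [pred J : {set E} | (J \in indep M) && (J \subset X)].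
have [|J /maxsetP[/andP[iJ sJX] maxJ] sIJ] := @maxset_exists _ P I.
  by rewrite /= iI.
exists J; split=> //; apply/eqP; rewrite eqn_leq rank_max //= leqNgt.
apply/negP; have [K [iK sKX <-]] := rank_witness X.
case/(indep_augment iJ iK)=> e; rewrite inE => /andP[eJ eK] iU.
move: eJ; rewrite -(maxJ (e |: J)) ?setU11 ?subsetUr //=.
by rewrite iU subUset sub1set (subsetP sKX).
Qed.

Lemma circuit_dep C : C \in circuits M -> C \notin indep M.
Proof. by rewrite inE => /minsetp. Qed.

Lemma circuit_min C D :
  C \in circuits M -> D \in circuits M -> D \subset C -> D = C.
Proof.
by rewrite !inE => /minsetP[_ minC] /minsetp depD sDC; apply: minC.
Qed.

Lemma circuitD1_indep C e :
  C \in circuits M -> e \in C -> C :\ e \in indep M.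
Proof.
rewrite inE => /minsetP[_ minC] eC; apply/negPn/negP => dep.
have := minC _ dep (subD1set C e).
by move/setP/(_ e); rewrite !inE eqxx eC.
Qed.

(** * Closure described by circuits *)

Lemma setD_set1_sub C X e : C :\: X = [set e] -> C :\ e \subset X.
Proof.
move=> CX; apply/subsetP=> x /setD1P[xe xC]; apply: contraR xe => xX.
by rewrite -in_set1 -CX inE xX.
Qed.

Lemma circuit_cl C X e : C \in circuits M -> C :\: X = [set e] -> e \in cl M X.
Proof.
move=> cC CXe; have /setDP[eC eX] : e \in C :\: X by rewrite CXe set11.
have sCX := setD_set1_sub CXe.
have [I [iI sCI sIX rI]] := indep_extend (circuitD1_indep cC eC) sCX.
rewrite inE eqn_leq [X in _ && X]rank_mono ?subsetUr // andbT leqNgt -rI.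
apply/negP; have [J [iJ sJX <-]] := rank_witness (e |: X).
(* The element [x] added to [I] is either [e], which makes [C] independent since [C :\ e] lies in
   [I], or in [X], which exceeds the rank of [X]. *)
case/(indep_augment iI iJ)=> x /setDP[xJ xI] iU.
have /setU1P[xe|xX] := subsetP sJX x xJ.
  case/negP: (circuit_dep cC); apply: indep_subset iU _.
  by rewrite xe -(setD1K eC) setUS.
have sUX : x |: I \subset X by rewrite subUset sub1set xX.
by have := rank_max iU sUX; rewrite -rI cardsU1 xI ltnn.
Qed.

(** Adding [e] to a maximal independent subset [I] of [X] makes it dependent; a circuit inside
    [e |: I] must contain [e], as [I] is independent. *)
Lemma cl_circuit X e : e \in cl M X -> e \notin X ->
  exists2 C, C \in circuits M & C :\: X = [set e].
Proof.
rewrite inE => /eqP re eX; have [I [iI sIX rI]] := rank_witness X.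
have eI : e \notin I by apply: contra eX => /(subsetP sIX).
have dep : e |: I \notin indep M.
  apply/negP=> iU; have := rank_max iU (setUS [set e] sIX).
  by rewrite re -rI cardsU1 eI ltnn.
have [C minC sC] :=
  @minset_exists _ (fun D : {set E} => D \notin indep M) _ dep.
exists C; first by rewrite inE.
have sub x : x \in C -> x \notin X -> x = e.
  move=> xC xX; have /setU1P[//|xI] := subsetP sC x xC.
  by rewrite (subsetP sIX) in xX.
apply/setP=> x; rewrite !inE; apply/andP/eqP => [[xX xC]|->]; first exact: sub.
split=> //; apply/negPn/negP => eC; case/negP: (minsetp minC).
apply: indep_subset iI _; apply/subsetP=> x' xC.
by have /setU1P[xe|//] := subsetP sC x' xC; rewrite -xe xC in eC.
Qed.

Lemma subset_cl X : X \subset cl M X.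
Proof. by apply/subsetP=> e eX; rewrite inE (setUidPr _) ?sub1set. Qed.

(** For [e] outside [Y], the circuit that puts [e] in the closure of [X] also puts it in that of
    [Y], so no inequality between ranks is involved. *)
Lemma cl_mono X Y : X \subset Y -> cl M X \subset cl M Y.
Proof.
move=> sXY; apply/subsetP=> e eX.
have [/(subsetP (subset_cl Y)) //|eY] := boolP (e \in Y).
have eX' : e \notin X by apply: contra eY => /(subsetP sXY).
have [C cC CX] := cl_circuit eX eX'; apply: (circuit_cl cC).
have eC : e \in C by have /setDP[] : e \in C :\: X by rewrite CX set11.
apply/eqP; rewrite eqEsubset -{1}CX setDS //= sub1set.
by rewrite inE eY.
Qed.

Lemma circuit_clD1 C e : C \in circuits M -> e \in C -> e \in cl M (C :\ e).
Proof.
move=> cC eC; apply: (circuit_cl cC).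
by rewrite setDDr setDv set0U; apply/setIidPr; rewrite sub1set.
Qed.

Lemma nonclosed_circuit X : X <> cl M X ->
  exists2 C, C \in circuits M & #|C :\: X| = 1.
Proof.
move/eqP; rewrite eqEsubset subset_cl /= => /subsetPn[e ecl eX].
have [C cC CX] := cl_circuit ecl eX.
by exists C => //; rewrite CX cards1.
Qed.

Lemma closed_circuit_card C X :
  C \in circuits M -> cl M X = X -> #|C :\: X| <> 1.
Proof.
move=> cC clX /eqP/cards1P[e CX].
have := circuit_cl cC CX; rewrite clX => eX.
by have /setDP[_ /negP] : e \in C :\: X by rewrite CX set11.
Qed.

(** * Tropical bases *)

Lemma tropical_basisS B B' : B' \subset circuits M -> B \subset B' ->
  tropical_basis M B -> tropical_basis M B'.
Proof.
move=> sB' sBB' [_ tB]; split=> // X /tB[C CB CX].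
by exists C => //; apply: (subsetP sBB').
Qed.

(** The boolean form gives access to [minset_exists] and turns a failure into an explicit set
    [X]. *)
Definition tropical_basisb B :=
  (B \subset circuits M) &&
  [forall X, (X != cl M X) ==> [exists C in B, #|C :\: X| == 1]].

Lemma tropical_basisP B : reflect (tropical_basis M B) (tropical_basisb B).
Proof.
apply: (iffP andP) => -[sB tB]; split=> //.
  move=> X /eqP nX; have /implyP/(_ nX) := forallP tB X.
  by case/exists_inP=> C CB /eqP CX; exists C.
apply/forallP=> X; apply/implyP=> /eqP/tB[C CB CX].
by apply/exists_inP; exists C => //; apply/eqP.
Qed.

Lemma minimal_tropical_basis_exists B : tropical_basis M B ->
  exists2 B', minimal_tropical_basis M B' & B' \subset B.
Proof.
move=> /tropical_basisP tB.
have [B' /minsetP[/tropical_basisP tB' minB'] sB'] :=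
  @minset_exists _ tropical_basisb _ tB.
exists B' => //; split=> // C CB' /tropical_basisP tD.
have := minB' _ tD (subD1set B' C).
by move/setP/(_ C); rewrite !inE eqxx CB'.
Qed.

(** * Closed circuits *)

Definition closed_circuits : {set {set E}} :=
  [set C in circuits M | cl M C == C].

Lemma closed_circuitsS B : tropical_basis M B -> closed_circuits \subset B.
Proof.
move=> [sB tB]; apply/subsetP=> C; rewrite inE => /andP[cC /eqP clC].
have [e eC] : exists e, e \in C.
  apply/set0Pn; apply: contraNneq (circuit_dep cC) => ->.
  exact: indep_set0.
have nX : C :\ e <> cl M (C :\ e).
  by move=> eqX; have := circuit_clD1 cC eC; rewrite -eqX !inE eqxx.
have [D DB /eqP/cards1P[d DX]] := tB _ nX.
have cD := subsetP sB D DB; rewrite -(circuit_min cC cD) //.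
(* Closedness of [C] catches the one element of [D] outside [C :\ e], so [D] lies in [C] and
   minimality of circuits applies. *)
have dC : d \in C.
  by rewrite -clC (subsetP (cl_mono (subD1set C e))) // (circuit_cl cD DX).
apply/subsetP=> x xD; have [/setD1P[] //|xX] := boolP (x \in C :\ e).
by have /set1P-> : x \in [set d] by rewrite -DX inE xX.
Qed.

Lemma essential_circuit_closed C : (forall e, ~~ is_loop M e) ->
  C \in circuits M -> ~ tropical_basis M (circuits M :\ C) -> cl M C = C.
Proof.
move=> loopless cC ntC.
have [X nX onlyC] : exists2 X, X <> cl M X &
    forall D, D \in circuits M -> #|D :\: X| = 1 -> D = C.
  move/tropical_basisP: ntC.
  rewrite /tropical_basisb subD1set /= => /forallPn[X].
  rewrite negb_imply => /andP[/eqP nX /exists_inPn noD]; exists X => // D cD DX.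
  apply/eqP; apply: contraTT isT => neqDC.
  by have := noD D; rewrite in_setD1 neqDC cD DX => /(_ isT).
have [C' cC' C'X] := nonclosed_circuit nX.
have := C'X; rewrite (onlyC _ cC' C'X) => {C' cC' C'X} /eqP/cards1P[e CX].
have /setDP[eC eX] : e \in C :\: X by rewrite CX set11.
have sCX := setD_set1_sub CX.
apply/eqP; rewrite eqEsubset subset_cl andbT; apply/subsetP=> f fclC.
apply/negPn/negP=> fC.
have rC : rank M C = rank M (C :\ e).
  by have := circuit_clD1 cC eC; rewrite inE (setD1K eC) => /eqP.
have rf : rank M (f |: C) = rank M C by move: fclC; rewrite inE => /eqP.
have fcl : f \in cl M (C :\ e).
  rewrite inE eqn_leq [X in _ && X]rank_mono ?subsetUr // andbT -rC -rf.
  by rewrite rank_mono // setUS // subD1set.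
(* Otherwise [f] is in the closure of [X], and a circuit leaving [X] only at [f] would have to be
   [C], which misses [f]. *)
have fX : f \in X.
  apply/negPn/negP=> fX.
  have [D cD DX] := cl_circuit (subsetP (cl_mono sCX) f fcl) fX.
  have DC : D = C by apply: onlyC => //; rewrite DX cards1.
  by case/negP: fC; have /setDP[] : f \in C :\: X by rewrite -DC DX set11.
have fCe : f \notin C :\ e by rewrite !inE (negPf fC) andbF.
have [C' cC' C'f] := cl_circuit fcl fCe.
have sub' x : x \in C' -> x != f -> x \in C :\ e.
  move=> xC' xf; apply: contraR xf => xC.
  by rewrite -in_set1 -C'f inE xC.
(* Looplessness enters here: the circuit [C'] is not reduced to [f]. *)
have [g gC' gf] : exists2 g, g \in C' & g != f.
  have /subsetPn[g gC' gf] : ~~ (C' \subset [set f]).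
    apply: contra (loopless f) => sC'f; rewrite /is_loop.
    suff -> : [set f] = C' by [].
    by apply/eqP; rewrite eqEsubset sC'f -C'f subsetDl.
  by exists g => //; rewrite -in_set1.
have gCe := sub' g gC' gf; have /setD1P[ge gC] := gCe.
(* Exchanging [g] for [f] in [C :\ e] keeps the closure, so [e] still depends on [Y], and [Y] stays
   inside [X]. *)
pose Y := f |: ((C :\ e) :\ g).
have gcl : g \in cl M Y.
  apply: (circuit_cl cC'); apply/setP=> x; rewrite !inE.
  apply/andP/eqP => [[xY xC']|->]; last by rewrite gC' eqxx (negPf gf).
  have [/eqP//|xg] := boolP (x == g).
  have [xf|xf] := boolP (x == f); first by rewrite xf in xY.
  by have := sub' x xC' xf; rewrite !inE => xCe; rewrite xCe xg orbT in xY.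
have ecl : e \in cl M Y.
  rewrite inE eqn_leq [X in _ && X]rank_mono ?subsetUr // andbT.
  move: gcl; rewrite inE => /eqP <-.
  have -> : g |: Y = f |: (C :\ e) by rewrite setUCA setD1K.
  move: fcl; rewrite inE => /eqP ->; rewrite -rC -rf rank_mono //.
  by rewrite setUCA setUS // -(setD1K eC) setUS // !setD1K // subD1set.
have sYX : Y \subset X.
  by rewrite subUset sub1set fX (subset_trans (subD1set _ _)).
have eY : e \notin Y by apply: contra eX => /(subsetP sYX).
(* [D] leaves [X] only at [e], hence is [C]; but [C] also leaves [Y] at [g]. *)
have [D cD DY] := cl_circuit ecl eY.
have DC : D = C.
  apply: onlyC => //; apply/eqP/cards1P; exists e.
  apply/eqP; rewrite eqEsubset -{1}DY setDS //= sub1set inE eX.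
  by have /setDP[] : e \in D :\: Y by rewrite DY set11.
have : g \in D :\: Y by rewrite DC !inE gC eqxx (negPf gf).
by rewrite DY inE (negPf ge).
Qed.

(** No circuit leaves a closed set in exactly one element, which settles one implication for every
    [X]; the other is the contrapositive of the covering condition. *)
Lemma closed_circuits_tropicalP :
  tropical_basis M closed_circuits <->
  (forall X, perp (~: X) closed_circuits <-> cl M X = X).
Proof.
have sub : closed_circuits \subset circuits M.
  by apply/subsetP=> C /setIdP[].
split=> [[_ tB] X|perpP].
  split=> [pX|clX C /(subsetP sub) cC]; last first.
    by rewrite setIC -setDE; apply: closed_circuit_card.
  apply/eqP; rewrite eq_sym; apply/negPn/negP=> /eqP/tB[C CB].
  by rewrite setDE setIC; apply: pX.
split=> // X nX.
have [/exists_inP[C CB /eqP CX]|/exists_inPn noC] :=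
  boolP [exists C in closed_circuits, #|C :\: X| == 1]; first by exists C.
case: nX; symmetry; apply/perpP=> C CB.
by rewrite setIC -setDE; apply/eqP/noC.
Qed.

Lemma unique_minimal_tropical_basisP : (forall e, ~~ is_loop M e) ->
  (exists! B, minimal_tropical_basis M B) <-> tropical_basis M closed_circuits.
Proof.
move=> loopless; split=> [[B [[tB _] uB]]|tF].
  apply: (tropical_basisS _ _ tB); first by apply/subsetP=> C /setIdP[].
  have [sB _] := tB; apply/subsetP=> C CB; have cC := subsetP sB C CB.
  (* If the circuits other than [C] formed a tropical basis, a minimal one among them would equal
     [B] by uniqueness, yet miss [C]. *)
  rewrite inE cC /=; apply/eqP/essential_circuit_closed => // tC.
  have [B' mB' sB'] := minimal_tropical_basis_exists tC.
  by have := subsetP sB' C; rewrite -(uB _ mB') !inE eqxx => /(_ CB).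
exists closed_circuits; split.
  split=> // C CF /closed_circuitsS/subsetP/(_ _ CF).
  by rewrite !inE eqxx.
(* A member of [B] that is not closed could be removed, since what remains still contains all closed
   circuits. *)
move=> B [tB minB]; apply/eqP; rewrite eqEsubset closed_circuitsS //=.
apply/subsetP=> C CB; apply/negPn/negP=> CF; apply: (minB C CB).
apply: tropical_basisS tF.
  by case: tB => sB _; apply: subset_trans (subD1set B C) sB.
by rewrite subsetD1 closed_circuitsS.
Qed.

End Matroid.

Theorem theorem4 (E : finType) (M : matroid E) (hM : simple_matroid M) :
  (exists! B : {set {set E}}, minimal_tropical_basis M B) <->
  (forall X : {set E},
     perp (~: X) [set C in circuits M | cl M C == C] <-> cl M X = X).
Proof.
have [loopless _] := hM.
apply: iff_trans (unique_minimal_tropical_basisP loopless) _.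
exact: closed_circuits_tropicalP.
Qed.
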